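(* Ordered Level Planarity with maximum degree $\Delta=2$ and level-width $\lambda=2$ reduces in linear time to T-Level Planarity with maximum degree $\Delta'=2$ and level-width $\lambda'=4$. That is, there is a linear-time algorithm which transforms every ordered level graph with maximum degree $2$ and level-width $2$ into a T-level graph with maximum degree $2$ and level-width $4$ such that the former has an ordered level planar drawing if and only if the latter has a T-level planar drawing.
   Context: A level graph $(G,\gamma)$ is a finite directed graph $G=(V,E)$ together with a surjective map $\gamma:V\to\{0,\dots,h\}$ (level assignment) such that $\gamma(u)<\gamma(v)$ for every edge $(u,v)\in E$. The $i$-th level is $V_i=\{v\in V\mid\gamma(v)=i\}$, its width is $\lambda_i=|V_i|$, and the level-width is $\lambda=\max_i\lambda_i$. $L_i$ denotes the horizontal line with $y$-coordinate $i$. A level planar drawing of $(G,\gamma)$ is a plane (crossing-free) drawing of $G$ in which each vertex $v$ has $y$-coordinate $\gamma(v)$ and each edge $(u,v)$ is realized as a $y$-monotone curve going upward from $u$ to $v$ (strictly increasing $y$-coordinate); in a plane drawing, edges do not pass through vertices other than their endpoints, and distinct edges meet only at common endpoints. The maximum degree is the maximum over all vertices of the total number (incoming plus outgoing) of incident edges. Ordered Level Planarity: an ordered level graph is a triple $(G,\gamma,\chi)$ where $(G,\gamma)$ is a level graph and $\chi:V\to\{0,\dots,\lambda-1\}$ restricts to a bijection $V_i\to\{0,\dots,\lambda_i-1\}$ for each $i$. An ordered level planar drawing is a level planar drawing of $(G,\gamma)$ in which each vertex $v$ has $x$-coordinate $\chi(v)$. The problem asks whether a given ordered level graph has an ordered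 level planar drawing. T-Level Planarity: a T-level graph is a triple $(G,\gamma,\mathcal T)$ where $(G,\gamma)$ is a level graph and $\mathcal T=(T_0,\dots,T_h)$ is a family of rooted trees where the set of leaves of $T_i$ is $V_i$. A T-level planar drawing is a level planar drawing of $(G,\gamma)$ such that for every level $V_i$ and every node $u$ of $T_i$, the leaves of the subtree of $T_i$ rooted at $u$ appear consecutively along $L_i$ (among the vertices of $V_i$). The problem asks whether a given T-level graph has a T-level planar drawing. *)

(* Defs.v *)
From Stdlib Require List.
From mathcomp Require Import all_boot all_order all_algebra.
From mathcomp Require Import all_classical all_reals all_analysis.

Set Implicit Arguments.
Unset Strict Implicit.
Unset Printing Implicit Defensive.

Import Order.TTheory GRing.Theory Num.Theory.
Import numFieldNormedType.Exports.

Local Open Scope classical_set_scope.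
Local Open Scope ring_scope.

(* The plane is R * R for an arbitrary R : realType. *)

(** * Level graphs *)

(* The vertices are numbered 0, ..., nvert - 1 and the edge set is listed
   without repetition, so that a graph can be handed to a machine; every
   finite level graph is of this form up to renaming its vertices. *)
Record level_graph := LevelGraph {
  nvert : nat;
  height : nat;
  edges : seq ('I_nvert * 'I_nvert);
  level : 'I_nvert -> 'I_height.+1;
  edges_uniq : uniq edges;
  level_surj : forall i, exists v, level v = i;
  level_incr : forall e, e \in edges -> (level e.1 < level e.2)%N
}.

Definition width (G : level_graph) (i : 'I_(height G).+1) : nat :=
  #|[pred v | level v == i]|.

Definition level_width (G : level_graph) : nat :=
  \max_(i < (height G).+1) width i.

Definition degree (G : level_graph) (v : 'I_(nvert G)) : nat :=
  count [pred e | (e.1 == v) || (e.2 == v)] (edges G).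

Definition max_degree (G : level_graph) : nat :=
  \max_(v < nvert G) degree v.

Record ordered_level_graph := OrderedLevelGraph {
  olg_graph :> level_graph;
  chi : 'I_(nvert olg_graph) -> nat;
  chi_bij : forall i,
    set_bij [set v | level v = i] [set k | (k < width i)%N] chi
}.

(* The children of a node are listed in some order; no notion below depends
   on that order. *)
Inductive rtree (V : Type) : Type :=
| Leaf of V
| Node of seq (rtree V).

Fixpoint leaves (V : Type) (t : rtree V) : seq V :=
  match t with
  | Leaf v => [:: v]
  | Node s => flatten (map (@leaves V) s)
  end.

Fixpoint subtrees (V : Type) (t : rtree V) : seq (rtree V) :=
  t :: match t with
       | Leaf _ => [::]
       | Node s => flatten (map (@subtrees V) s)
       end.

(* A childless Node would be a leaf of the tree that is not a vertex of the
   graph. *)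
Fixpoint inner_nodes_have_children (V : Type) (t : rtree V) : bool :=
  match t with
  | Leaf _ => true
  | Node s => (0 < size s)%N && all (@inner_nodes_have_children V) s
  end.

Record T_level_graph := TLevelGraph {
  tlg_graph :> level_graph;
  tree : 'I_(height tlg_graph).+1 -> rtree 'I_(nvert tlg_graph);
  tree_inner : forall i, inner_nodes_have_children (tree i);
  tree_leaves_uniq : forall i, uniq (leaves (tree i));
  tree_leavesE : forall i v, (v \in leaves (tree i)) = (level v == i)
}.

(** * Drawings *)

(* The values of [curve] outside [edges G], and of each curve outside the
   parameter interval [0, 1], are irrelevant. *)
Record drawing (R : realType) (G : level_graph) := Drawing {
  xcoord : 'I_(nvert G) -> R;
  curve : 'I_(nvert G) * 'I_(nvert G) -> R -> R * R
}.

Definition position (R : realType) (G : level_graph) (D : drawing R G)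
    (v : 'I_(nvert G)) : R * R :=
  (xcoord D v, (level v : nat)%:R).

Definition upward_curve (R : realType) (c : R -> R * R) (p q : R * R) : Prop :=
  [/\ {within `[0, 1], continuous c},
      c 0 = p,
      c 1 = q &
      forall s t, 0 <= s -> s < t -> t <= 1 -> (c s).2 < (c t).2].

Definition on_curve (R : realType) (c : R -> R * R) (p : R * R) : Prop :=
  exists t, [/\ 0 <= t, t <= 1 & c t = p].

Definition is_end (V : eqType) (v : V) (e : V * V) : bool :=
  (v == e.1) || (v == e.2).

Record level_planar (R : realType) (G : level_graph) (D : drawing R G) : Prop :=
  LevelPlanar {
  vertices_distinct : injective (position D);
  edges_upward : forall e, e \in edges G ->
    upward_curve (curve D e) (position D e.1) (position D e.2);
  edges_avoid_vertices : forall e v, e \in edges G ->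
    on_curve (curve D e) (position D v) -> is_end v e;
  edges_crossing_free : forall e f p, e \in edges G -> f \in edges G ->
    e <> f -> on_curve (curve D e) p -> on_curve (curve D f) p ->
    exists v, [/\ is_end v e, is_end v f & p = position D v]
}.

Definition ordered_level_planar (R : realType) (G : ordered_level_graph) : Prop :=
  exists D : drawing R G,
    level_planar D /\ forall v, xcoord D v = (chi v)%:R.

Definition T_level_planar (R : realType) (G : T_level_graph) : Prop :=
  exists D : drawing R G,
    level_planar D /\
    forall (i : 'I_(height G).+1) (u : rtree 'I_(nvert G)),
      List.In u (subtrees (tree i)) ->
      forall a b c, a \in leaves u -> b \in leaves u -> level c = i ->
        xcoord D a < xcoord D c -> xcoord D c < xcoord D b -> c \in leaves u.

(** * Linear time

   The machine is a word RAM with registers, a zero-initialised memory and an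
   output tape.  Programs are structured (sequence, conditional, loop) rather
   than flat lists of jumps, which changes running times by at most a constant
   factor.  A word is a natural number at most [W]; a run whose next
   instruction would produce a larger word is stuck. *)

Inductive prog : Type :=
| Skip
| Const (d k : nat)          (* reg d := k *)
| Plus (d a b : nat)         (* reg d := reg a + reg b *)
| Minus (d a b : nat)        (* reg d := reg a - reg b, truncated at 0 *)
| MemRead (d a : nat)        (* reg d := mem (reg a) *)
| MemWrite (a b : nat)       (* mem (reg a) := reg b *)
| Emit (a : nat)             (* append reg a to the output *)
| Seq (p q : prog)
| IfLt (a b : nat) (p q : prog)
| WhileLt (a b : nat) (p : prog).

Record state := State { register : nat -> nat; memory : nat -> nat; emitted : seq nat }.

Definition write_register (s : state) (d k : nat) : state :=
  State [eta register s with d |-> k] (memory s) (emitted s).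

Definition write_memory (s : state) (a k : nat) : state :=
  State (register s) [eta memory s with a |-> k] (emitted s).

Definition emit (s : state) (k : nat) : state :=
  State (register s) (memory s) (rcons (emitted s) k).

Definition initial (input : seq nat) : state :=
  State (fun=> 0%N) (nth 0%N input) [::].

(* [exec W p s t s'] : with words at most W, the program p started in state s
   halts after t steps in state s'. *)
Inductive exec (W : nat) : prog -> state -> nat -> state -> Prop :=
| ExecSkip s : exec W Skip s 1 s
| ExecConst s d k :
    (k <= W)%N -> exec W (Const d k) s 1 (write_register s d k)
| ExecPlus s d a b :
    (register s a + register s b <= W)%N ->
    exec W (Plus d a b) s 1 (write_register s d (register s a + register s b)%N)
| ExecMinus s d a b :
    (register s a - register s b <= W)%N ->
    exec W (Minus d a b) s 1 (write_register s d (register s a - register s b)%N)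
| ExecMemRead s d a :
    (memory s (register s a) <= W)%N ->
    exec W (MemRead d a) s 1 (write_register s d (memory s (register s a)))
| ExecMemWrite s a b : exec W (MemWrite a b) s 1 (write_memory s (register s a) (register s b))
| ExecEmit s a : exec W (Emit a) s 1 (emit s (register s a))
| ExecSeq p q s s1 s2 t1 t2 :
    exec W p s t1 s1 -> exec W q s1 t2 s2 -> exec W (Seq p q) s (t1 + t2) s2
| ExecIfTrue a b p q s s' t :
    (register s a < register s b)%N -> exec W p s t s' -> exec W (IfLt a b p q) s t.+1 s'
| ExecIfFalse a b p q s s' t :
    (register s b <= register s a)%N -> exec W q s t s' -> exec W (IfLt a b p q) s t.+1 s'
| ExecWhileTrue a b p s s1 s2 t1 t2 :
    (register s a < register s b)%N -> exec W p s t1 s1 ->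
    exec W (WhileLt a b p) s1 t2 s2 ->
    exec W (WhileLt a b p) s (t1 + t2).+1 s2
| ExecWhileFalse a b p s :
    (register s b <= register s a)%N -> exec W (WhileLt a b p) s 1 s.

(* The word bound is linear in the input length N, i.e. words have
   log N + O(1) bits. *)
Definition computes_in_linear_time (p : prog) (C : nat)
    (input output : seq nat) : Prop :=
  exists (t : nat) (s : state),
    [/\ exec (C * size input) p (initial input) t s,
        (t <= C * size input)%N & emitted s = output].

(** * Encodings of the instances

   Both encodings have length linear in the number of vertices and edges
   (and tree nodes); height <= nvert because levels are nonempty. *)

Definition encode_graph (G : level_graph) : seq nat :=
  [:: nvert G; height G; size (edges G)]
  ++ [seq nat_of_ord (level v) | v <- enum 'I_(nvert G)]
  ++ flatten [seq [:: nat_of_ord e.1; nat_of_ord e.2] | e <- edges G].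

Definition encode_ordered (G : ordered_level_graph) : seq nat :=
  encode_graph G ++ [seq chi v | v <- enum 'I_(nvert G)].

(* Preorder; since inner nodes have at least one child, the number 0
   unambiguously announces a leaf. *)
Fixpoint encode_tree (n : nat) (t : rtree 'I_n) : seq nat :=
  match t with
  | Leaf v => [:: 0%N; nat_of_ord v]
  | Node s => size s :: flatten (map (@encode_tree n) s)
  end.

Definition encode_T (G : T_level_graph) : seq nat :=
  encode_graph G
  ++ flatten [seq encode_tree (tree i) | i <- enum 'I_(height G).+1].

(* Main.v *)
(* Add to the graph two vertical paths, the posts, each with one vertex per
   level, and on level i let the tree group the left post with the vertex of
   rank 0 and the right post with the vertex of rank 1.  An ordered drawing
   fits between two far away straight posts.  Conversely, the posts cannot
   cross, so they keep their order on all levels, and consecutiveness then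
   forces the order of the original vertices up to one global reflection.
   Since a level has at most two vertices, an affine map with a slope of
   constant sign moves them to 0 and 1, and interpolating these maps in the
   height gives a level-preserving homeomorphism of the strip. *)
Require Import Defs.
From mathcomp Require Import all_boot all_order all_algebra.
From mathcomp Require Import all_classical all_reals all_analysis.
From mathcomp Require Import zify ring lra.

Set Implicit Arguments.
Unset Strict Implicit.
Unset Printing Implicit Defensive.

Import Order.TTheory GRing.Theory Num.Theory.
Import numFieldNormedType.Exports.

(** * The word RAM program *)

Section Machine.
Local Open Scope nat_scope.

(** The machine must print the encoding of the new graph literally, so the numbering of the posts
    and the order of the new edges are chosen to suit it. Old vertices keep their numbers and the
    posts of level [i] get [n + 2i] and [n + 2i + 1]; then the old lists are copied verbatim and the
    new ones come from counters. Only the trees need rearranging: the vertices arrive in no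
    particular order of levels, and a table with two cells per level sorts them in one pass, an
    empty cell being recognised by the initial value 0 of the memory. On the geometric side nothing
    fixes which post lies on the left, and the sign of the slopes absorbs this. Equal signs on all
    levels are exactly what keeps an interpolated slope away from 0 between levels. Curves are
    merely continuous with increasing height, so two of them can be compared at equal heights only
    after a reparametrisation, and compactness provides the room for the posts. *)

Definition config (rs : seq nat) (mem : nat -> nat) (out : seq nat) : state :=
  State (nth 0 rs) mem out.

Lemma write_config rs mem out d k :
  write_register (config rs mem out) d k = config (set_nth 0 rs d k) mem out.
Proof.
by rewrite /config /write_register /=; congr State; apply/funext => i; rewrite nth_set_nth.
Qed.

Variable W : nat.

(** Total correctness with a time budget. Keeping only an upper bound on the number of steps lets
    branches of different cost share one statement. *)
Definition runs (p : prog) (s : state) (T : nat) (Q : state -> Prop) : Prop :=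
  exists t s', [/\ exec W p s t s', t <= T & Q s'].

Lemma runs_skip s T (Q : state -> Prop) : Q s -> runs Skip s T.+1 Q.
Proof. by move=> Qs; exists 1, s; split=> //; apply: ExecSkip. Qed.

Lemma runs_seq p q s T1 T2 T (P Q : state -> Prop) :
  runs p s T1 P -> (forall s1, P s1 -> runs q s1 T2 Q) -> T1 + T2 <= T ->
  runs (Seq p q) s T Q.
Proof.
move=> [t1 [s1 [e1 le1 /[swap] /[apply] -[t2 [s2 [e2 le2 Qs]]]]]] leT.
exists (t1 + t2), s2; split=> //; first exact: ExecSeq e1 e2.
exact: leq_trans (leq_add le1 le2) leT.
Qed.

Lemma runs_weaken p s T T' (P Q : state -> Prop) :
  runs p s T P -> T <= T' -> (forall s', P s' -> Q s') -> runs p s T' Q.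
Proof.
move=> [t [s' [e le Ps]]] leT PQ; exists t, s'; split=> //; last exact: PQ.
exact: leq_trans leT.
Qed.

Lemma runs_step p q s s1 T Q :
  exec W p s 1 s1 -> runs q s1 T Q -> runs (Seq p q) s T.+1 Q.
Proof.
move=> e1 [t [s2 [e2 le Qs]]]; exists (1 + t), s2.
by split=> //; apply: ExecSeq e1 e2.
Qed.

Section Steps.
Variables (q : prog) (rs : seq nat) (mem : nat -> nat) (out : seq nat).
Variables (T : nat) (Q : state -> Prop).

Lemma runs_const d k : k <= W ->
  runs q (config (set_nth 0 rs d k) mem out) T Q ->
  runs (Seq (Const d k) q) (config rs mem out) T.+1 Q.
Proof. by move=> le; rewrite -write_config; apply: runs_step; apply: ExecConst. Qed.

Lemma runs_plus d a b : nth 0 rs a + nth 0 rs b <= W ->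
  runs q (config (set_nth 0 rs d (nth 0 rs a + nth 0 rs b)) mem out) T Q ->
  runs (Seq (Plus d a b) q) (config rs mem out) T.+1 Q.
Proof. by move=> le; rewrite -write_config; apply: runs_step; apply: (ExecPlus d). Qed.

Lemma runs_minus d a b : nth 0 rs a - nth 0 rs b <= W ->
  runs q (config (set_nth 0 rs d (nth 0 rs a - nth 0 rs b)) mem out) T Q ->
  runs (Seq (Minus d a b) q) (config rs mem out) T.+1 Q.
Proof. by move=> le; rewrite -write_config; apply: runs_step; apply: (ExecMinus d). Qed.

Lemma runs_read d a x : mem (nth 0 rs a) = x -> x <= W ->
  runs q (config (set_nth 0 rs d x) mem out) T Q ->
  runs (Seq (MemRead d a) q) (config rs mem out) T.+1 Q.
Proof.
by move=> <- le; rewrite -write_config; apply: runs_step; apply: (ExecMemRead d).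
Qed.

Lemma runs_write a b :
  runs q (config rs [eta mem with nth 0 rs a |-> nth 0 rs b] out) T Q ->
  runs (Seq (MemWrite a b) q) (config rs mem out) T.+1 Q.
Proof. by apply: runs_step; apply: (ExecMemWrite _ (config _ _ _)). Qed.

Lemma runs_emit a :
  runs q (config rs mem (rcons out (nth 0 rs a))) T Q ->
  runs (Seq (Emit a) q) (config rs mem out) T.+1 Q.
Proof. by apply: runs_step; apply: (ExecEmit _ (config _ _ _)). Qed.

End Steps.

Lemma runs_if a b p q s T (Q : state -> Prop) :
  runs (if register s a < register s b then p else q) s T Q ->
  runs (IfLt a b p q) s T.+1 Q.
Proof.
case: ltnP => lt_ab [t [s' [e le Qs]]]; exists t.+1, s'; split=> //.
  exact: ExecIfTrue.
exact: ExecIfFalse.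
Qed.

(** The invariant counts the completed rounds, which fixes their number as exactly [K]. Each round
    pays one step for its test; the failing last test is the outer successor. *)
Lemma runs_while a b p (I : nat -> state -> Prop) K T s :
  (forall k s, k < K -> I k s ->
     register s a < register s b /\ runs p s T (I k.+1)) ->
  (forall s, I K s -> register s b <= register s a) ->
  I 0 s -> runs (WhileLt a b p) s (K * T.+1).+1 (I K).
Proof.
move=> step stop I0.
suff loop j : forall k s, k + j = K -> I k s -> runs (WhileLt a b p) s (j * T.+1).+1 (I K).
  by apply: (loop K 0).
elim: j => [|j IHj] k {I0}s.
  rewrite addn0 => -> Is; exists 1, s; split=> //.
  by apply: ExecWhileFalse; apply: stop.
move=> kK Is; have ltkK : k < K by rewrite -kK -addSnnS leq_addr.
have [lt_ab [t1 [s1 [e1 le1 Is1]]]] := step _ _ ltkK Is.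
have [|t2 [s2 [e2 le2 Is2]]] := IHj k.+1 s1 _ Is1; first by rewrite addSnnS.
exists (t1 + t2).+1, s2; split=> //; first exact: ExecWhileTrue e1 e2.
by rewrite ltnS; apply: leq_trans (leq_add le1 le2) _; rewrite addnS mulSn addSn.
Qed.

End Machine.

(** * The reduction as a program, its output and its running time *)

Section Reduction.
Local Open Scope nat_scope.

Definition block : seq prog -> prog := foldr Seq Skip.

(* Register 0 always holds 0; after [read_header], registers 1 to 6 hold
   1, n, h, 2, m and h + 1 for n vertices, levels 0 to h and m edges. *)
Definition read_header : prog := block
  [:: Const 1 1; MemRead 2 0; MemRead 3 1; Plus 4 1 1; MemRead 5 4; Plus 6 3 1;
      Plus 7 6 6; Plus 7 2 7; Emit 7; Emit 3; Plus 7 3 3; Plus 7 5 7; Emit 7;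
      Plus 8 4 1; Plus 9 8 2].

(** Registers 8 and 9 delimit the cells to copy and agree on exit, so raising register 9 alone
    selects the next stretch of the input. *)
Definition copy_segment : prog :=
  WhileLt 8 9 (block [:: MemRead 10 8; Emit 10; Plus 8 8 1]).

Definition emit_post_levels : prog :=
  WhileLt 10 6 (block [:: Emit 10; Emit 10; Plus 10 10 1]).

(** Register 11 walks through [x], [x + 2], [x + 1], [x + 3] and stops at [x + 2]: these are both
    edges to the next level, since a post vertex and its successor differ by 2. *)
Definition emit_post_edges : prog :=
  WhileLt 10 3 (block
    [:: Emit 11; Plus 11 11 4; Emit 11; Minus 11 11 1; Emit 11; Plus 11 11 4;
        Emit 11; Minus 11 11 1; Plus 10 10 1]).

(* Writes v + 1 to the cell of index 2 level(v) + chi(v) of a table beyond the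
   input; the cells that stay 0 correspond to no vertex. *)
Definition fill_table : prog :=
  WhileLt 8 12 (block
    [:: Plus 13 13 1; MemRead 14 10; Plus 14 14 14; MemRead 15 8; Plus 14 14 15;
        Plus 14 14 12; MemWrite 14 13; Plus 10 10 1; Plus 8 8 1]).

Definition emit_half_tree : prog := block
  [:: MemRead 14 8;
      IfLt 0 14
        (block [:: Emit 4; Emit 0; Emit 11; Emit 0; Minus 14 14 1; Emit 14])
        (block [:: Emit 1; Emit 0; Emit 11]);
      Plus 8 8 1; Plus 11 11 1].

Definition emit_trees : prog :=
  WhileLt 10 6 (block [:: Emit 4; emit_half_tree; emit_half_tree; Plus 10 10 1]).

(** The output follows the layout of [encode_T]. When register 12 is set, register 8 points to the
    first rank, so the sum is the input length, which is where the table starts. *)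
Definition reduction : prog := block
  [:: read_header; copy_segment; Const 10 0; emit_post_levels;
      Plus 9 9 5; Plus 9 9 5; copy_segment;
      Const 10 0; Plus 11 2 0; emit_post_edges;
      Plus 12 8 2; Plus 10 4 1; Const 13 0; fill_table;
      Const 10 0; Plus 11 2 0; emit_trees].

Definition half_tree_code (post slot : nat) : seq nat :=
  if slot is v.+1 then [:: 2; 0; post; 0; v] else [:: 1; 0; post].

Variables (W n h m : nat) (lev ends ords : seq nat) (slot : nat -> nat -> nat).

Let input : seq nat := [:: n; h; m] ++ lev ++ ends ++ ords.
Let base : nat := (n + m + m + n).+3.

Hypothesis size_lev : size lev = n.
Hypothesis size_ends : size ends = m + m.
Hypothesis size_ords : size ords = n.
Hypothesis lev_le : forall x, x \in lev -> x <= h.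
Hypothesis ends_lt : forall x, x \in ends -> x < n.
Hypothesis ords_lt : forall x, x \in ords -> x < 2.
Hypothesis lt_hn : h < n.
(** The largest words are table addresses, at most [base + 2(h + 1)]; as [h < n], they stay below
    this bound. *)
Hypothesis le_W : 3 * base <= W.
Hypothesis slot_vertex : forall v, v < n -> slot (nth 0 lev v) (nth 0 ords v) = v.+1.
Hypothesis vertex_slot : forall i c v, slot i c = v.+1 ->
  [/\ v < n, nth 0 lev v = i & nth 0 ords v = c].

Let regs x7 x8 x9 x10 x11 x12 x13 x14 x15 : seq nat :=
  [:: 0; 1; n; h; 2; m; h.+1; x7; x8; x9; x10; x11; x12; x13; x14; x15].

Let post_edges i := [:: n + i.*2; n + i.*2.+2; n + i.*2.+1; n + i.*2.+3].
Let tree_code i :=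
  2 :: half_tree_code (n + i.*2) (slot i 0) ++ half_tree_code (n + i.*2.+1) (slot i 1).

Lemma size_input : size input = base.
Proof. rewrite /input /base !size_cat size_lev size_ends size_ords /=; lia. Qed.

Lemma input_le x : x \in input -> x <= base.
Proof.
have := lt_hn; have := lev_le; have := ends_lt; have := ords_lt.
rewrite /input /base !inE !mem_cat => O E L hn; case/or4P => [|||/or3P[/L|/E|/O]]; lia.
Qed.

Lemma run_header :
  runs W read_header (initial input) 16
    (eq (config [:: 0; 1; n; h; 2; m; h.+1; m + h.*2; 3; n.+3] (nth 0 input)
           [:: n + h.+1.*2; h; m + h.*2])).
Proof.
have -> : initial input = config [::] (nth 0 input) [::].
  by congr State; apply/funext=> i; rewrite nth_nil.
have [Hb Hn] : base = (n + m + m + n).+3 /\ h < n by [].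
have HW := le_W.
apply: runs_const; first lia.
apply: (runs_read (x := n)) => //=; first lia.
apply: (runs_read (x := h)) => //=; first lia.
apply: runs_plus => /=; first lia.
apply: (runs_read (x := m)) => //=; first lia.
do !(first [apply: runs_plus|apply: runs_emit] => /=; try lia).
apply: runs_skip; rewrite !addn1 -!addnn //.
Qed.

Lemma run_copy a (L : seq nat) mem out x7 x9 x10 x11 x12 x13 x14 x15 :
  x9 = a + size L -> x9 <= W -> (forall x, x \in L -> x <= W) ->
  (forall j, j < size L -> mem (a + j) = nth 0 L j) ->
  runs W copy_segment (config (regs x7 a x9 x10 x11 x12 x13 x14 x15) mem out)
    (size L * 5).+1
    (fun s => exists y, s = config (regs x7 x9 x9 y x11 x12 x13 x14 x15) mem (out ++ L)).
Proof.
move=> Dx9 le9 leL memL.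
pose I k s := exists y,
  s = config (regs x7 (a + k) x9 y x11 x12 x13 x14 x15) mem (out ++ take k L).
apply: runs_weaken (runs_while (I := I) (K := size L) (T := 4) _ _ _) _ _ => //.
- move=> k _ ltk [y ->]; split; first by rewrite /=; lia.
  apply: (runs_read (x := nth 0 L k)); [exact: memL|by apply/leL/mem_nth|].
  apply: runs_emit; apply: runs_plus => /=; first lia.
  apply: runs_skip; exists (nth 0 L k).
  by rewrite (take_nth 0) // -rcons_cat addn1 addnS.
- by move=> s [y ->] /=; lia.
- by exists x10; rewrite addn0 take0 cats0.
- by move=> s [y ->]; exists y; rewrite take_size Dx9.
Qed.

Lemma run_post_levels mem out x7 x8 x9 x11 x12 x13 x14 x15 :
  runs W emit_post_levels (config (regs x7 x8 x9 0 x11 x12 x13 x14 x15) mem out)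
    (h.+1 * 5).+1
    (eq (config (regs x7 x8 x9 h.+1 x11 x12 x13 x14 x15) mem
           (out ++ flatten (mkseq (fun i => [:: i; i]) h.+1)))).
Proof.
have HW := le_W; have Hb : base = (n + m + m + n).+3 by []; have Hn := lt_hn.
pose I k := eq (config (regs x7 x8 x9 k x11 x12 x13 x14 x15) mem
                  (out ++ flatten (mkseq (fun i => [:: i; i]) k))).
apply: runs_weaken (runs_while (I := I) (K := h.+1) (T := 4) _ _ _) _ _ => //.
- move=> k _ ltk <-; split=> //.
  do 2 apply: runs_emit; apply: runs_plus => /=; first lia.
  by apply: runs_skip; rewrite /I mkseqS flatten_rcons addn1 -!cats1 -!catA.
- by move=> s <-.
- by rewrite /I /= cats0.
Qed.

Lemma run_post_edges mem out x7 x8 x9 x12 x13 x14 x15 :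
  runs W emit_post_edges (config (regs x7 x8 x9 0 n x12 x13 x14 x15) mem out)
    (h * 11).+1
    (fun s => exists x11, s = config (regs x7 x8 x9 h x11 x12 x13 x14 x15) mem
           (out ++ flatten (mkseq post_edges h))).
Proof.
have HW := le_W; have Hb : base = (n + m + m + n).+3 by []; have Hn := lt_hn.
pose I k := eq (config (regs x7 x8 x9 k (n + k.*2) x12 x13 x14 x15) mem
                  (out ++ flatten (mkseq post_edges k))).
apply: runs_weaken (runs_while (I := I) (K := h) (T := 10) _ _ _) _ _ => //.
- move=> k _ ltk <-; split=> //.
  do !(first [apply: runs_plus|apply: runs_minus|apply: runs_emit] => /=; try lia).
  apply: runs_skip; rewrite /I mkseqS flatten_rcons addn1 -!cats1 -!catA /=.
  congr (config _ _ (_ ++ _ ++ _)); last by rewrite /post_edges; congr [:: _; _; _; _]; lia.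
  by rewrite /regs; congr [:: _, _, _, _, _, _, _, _, _, _, _, _ & _]; lia.
- by move=> s <-.
- by rewrite /I /= cats0 addn0.
- by move=> s <-; exists (n + h.*2).
Qed.

Lemma run_table out x7 x9 x11 x14 x15 :
  runs W fill_table
    (config (regs x7 (n + m + m).+3 x9 3 x11 base 0 x14 x15) (nth 0 input) out)
    (n * 11).+1
    (fun s => exists x10 x14 x15 mem,
       s = config (regs x7 base x9 x10 x11 base n x14 x15) mem out /\
       forall i c, i <= h -> c < 2 -> mem (base + i.*2 + c) = slot i c).
Proof.
have HW := le_W; have Hb : base = (n + m + m + n).+3 by []; have Hn := lt_hn.
(* Vertex [v] is stored in round [v] as [v + 1], so after [k] rounds the codes up to [k] are in
   place. Empty slots have code 0 and agree with the untouched memory throughout. *)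
pose I k s := exists y14 y15 mem,
  [/\ s = config (regs x7 (n + m + m + k).+3 x9 k.+3 x11 base k y14 y15) mem out,
      forall a, a < base -> mem a = nth 0 input a &
      forall i c, i <= h -> c < 2 -> mem (base + i.*2 + c) =
        if slot i c <= k then slot i c else 0].
have lev_at k : k < n -> nth 0 input k.+3 = nth 0 lev k.
  by move=> ltk; rewrite /input /= nth_cat size_lev ltk.
have ords_at k : nth 0 input (n + m + m + k).+3 = nth 0 ords k.
  rewrite /input !nth_cat size_lev size_ends /=.
  do 3?case: ifP; rewrite ?addnS; try lia.
  by move=> *; congr nth; lia.
apply: runs_weaken (runs_while (I := I) (K := n) (T := 10) _ _ _) _ _ => //.
- move=> k _ ltk [y14 [y15 [mem [-> mem_in mem_tab]]]]; split; first by rewrite /=; lia.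
  have le_l : nth 0 lev k <= h by apply: lev_le; rewrite mem_nth ?size_lev.
  have lt_o : nth 0 ords k < 2 by apply: ords_lt; rewrite mem_nth ?size_ords.
  apply: runs_plus => /=; first lia.
  apply: (runs_read (x := nth 0 lev k)); [by rewrite /= mem_in ?lev_at //; lia|lia|].
  apply: runs_plus => /=; first lia.
  apply: (runs_read (x := nth 0 ords k)); [by rewrite /= mem_in ?ords_at //; lia|lia|].
  do 2!(apply: runs_plus => /=; first lia).
  apply: runs_write => /=.
  do 2!(apply: runs_plus => /=; first lia).
  apply: runs_skip; do 3 eexists; split; first by rewrite !addn1 ?addnS.
    by move=> a lta /=; case: eqP => [|_]; [lia|exact: mem_in].
  (* Ranks are below 2, so the address determines level and rank. The slot of any other cell is not
     [k + 1], hence raising the threshold from [k] to [k + 1] does not affect it. *)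
  move=> i c lei ltc /=; case: eqP => [eq_ic|ne_ic].
    have -> : i = nth 0 lev k by lia.
    have -> : c = nth 0 ords k by lia.
    by rewrite slot_vertex // leqnn.
  rewrite mem_tab //; have : slot i c <> k.+1.
    by move=> /vertex_slot[_ Di Dc]; apply: ne_ic; lia.
  by do 2![case: ifP] => //; lia.
- by move=> s [y14 [y15 [mem [-> _ _]]]] /=; lia.
- exists x14, x15, (nth 0 input); split=> //; first by rewrite !addn0.
  move=> i c _ _; rewrite nth_default ?size_input; last lia.
  by case: ifP => //; lia.
- move=> s [y14 [y15 [mem [-> _ tab]]]]; exists n.+3, y14, y15, mem; split=> //.
  move=> i c lei ltc; rewrite tab //.
  by case D: (slot i c) => [|v] //; have [-> _ _] := vertex_slot D.
Qed.

Lemma run_half_tree mem out x x7 x8 x9 x10 x11 x12 x13 x14 x15 :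
  mem x8 = x -> x <= W -> x8 < W -> x11 < W ->
  runs W emit_half_tree (config (regs x7 x8 x9 x10 x11 x12 x13 x14 x15) mem out) 14
    (fun s => exists x14,
      s = config (regs x7 x8.+1 x9 x10 x11.+1 x12 x13 x14 x15) mem
            (out ++ half_tree_code x11 x)).
Proof.
move=> Dx leW lt8 lt11; apply: (runs_read Dx leW) => /=.
pose P s := exists y,
  s = config (regs x7 x8 x9 x10 x11 x12 x13 y x15) mem (out ++ half_tree_code x11 x).
apply: (@runs_seq W _ _ _ 9 4 13 P) => //.
  apply: runs_if => /=; case: x leW {Dx} @P => [|v] leW P /=.
    do 3 apply: runs_emit => /=; apply: runs_skip; exists 0.
    by rewrite -!cats1 -!catA.
  do !(first [apply: runs_minus|apply: runs_emit] => /=; try lia).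
  by apply: runs_skip; exists v; rewrite -!cats1 -!catA subn1.
move=> _ [y ->].
do 2!(apply: runs_plus => /=; first lia).
by apply: runs_skip; exists y; rewrite !addn1.
Qed.

Lemma run_trees mem out x7 x9 x12 x13 x14 x15 :
  (forall i c, i <= h -> c < 2 -> mem (base + i.*2 + c) = slot i c) ->
  runs W emit_trees (config (regs x7 base x9 0 n x12 x13 x14 x15) mem out)
    (h.+1 * 32).+1
    (fun s => emitted s = out ++ flatten (mkseq tree_code h.+1)).
Proof.
move=> tab.
have HW := le_W; have Hb : base = (n + m + m + n).+3 by []; have Hn := lt_hn.
have slot_le i c : slot i c <= W.
  by case D: (slot i c) => [|v] //; have [ltv _ _] := vertex_slot D; lia.
pose I k s := exists y14,
  s = config (regs x7 (base + k.*2) x9 k (n + k.*2) x12 x13 y14 x15) mem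
        (out ++ flatten (mkseq tree_code k)).
apply: runs_weaken (runs_while (I := I) (K := h.+1) (T := 31) _ _ _) _ _ => //.
- move=> k _ ltk [y ->]; split=> //.
  apply: runs_emit => /=.
  apply: (@runs_seq _ _ _ _ 14 16 30); last by [].
    apply: (@run_half_tree _ _ (slot k 0)) => //; try lia.
    by rewrite -tab // addn0.
  move=> _ [z ->].
  apply: (@runs_seq _ _ _ _ 14 2 16); last by [].
    apply: (@run_half_tree _ _ (slot k 1)) => //; try lia.
    by rewrite -tab // addn1.
  move=> _ [t ->]; apply: runs_plus => /=; first lia.
  apply: runs_skip; exists t.
  rewrite mkseqS flatten_rcons addn1 -!cats1 -!catA doubleS !addnS /=.
  by rewrite /tree_code addnS.
- by move=> s [y ->].
- by exists x14; rewrite /= cats0 !addn0.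
- by move=> s [y ->].
Qed.

Lemma run_reduction :
  runs W reduction (initial input) (100 * base)
    (fun s => emitted s = [:: n + h.+1.*2; h; m + h.*2]
       ++ lev ++ flatten (mkseq (fun i => [:: i; i]) h.+1)
       ++ ends ++ flatten (mkseq post_edges h)
       ++ flatten (mkseq tree_code h.+1)).
Proof.
have HW := le_W; have Hb : base = (n + m + m + n).+3 by []; have Hn := lt_hn.
have mem_input s : {subset s <= input} -> forall x, x \in s -> x <= W.
  by move=> sub x /sub /input_le; lia.
(* Budgets for what remains to be run, built from the last phase backwards. With [h < n] the total
   is at most [64n + 10m] plus a constant, well within [100 * base]. *)
pose T := 2 + (h.+1 * 32).+1.
pose T1 := 3 + (n * 11).+1 + T; pose T2 := 2 + (h * 11).+1 + (3 + T1).
pose T3 := 3 + (m + m) * 5 + T2; pose T4 := (n * 5).+2 + (1 + (h.+1 * 5).+1 + T3).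
apply: (@runs_seq _ _ _ _ 16 T4 _); first exact: run_header; last by rewrite /T4 /T3 /T2 /T1 /T; lia.
move=> _ <-.
(* Registers past the end of the list read 0, so padding ten entries to sixteen does not change the
   state. *)
have -> out mem : config [:: 0; 1; n; h; 2; m; h.+1; m + h.*2; 3; n.+3] mem out =
    config (regs (m + h.*2) 3 n.+3 0 0 0 0 0 0) mem out.
  by congr State; apply/funext => i; do 16?[case: i => [//|i]]; rewrite /= !nth_nil.
apply: (@runs_seq _ _ _ _ (size lev * 5).+1 (1 + (1 + (h.+1 * 5).+1 + T3)) _).
- apply: (@run_copy 3 lev); [by rewrite size_lev|lia| |].
    by apply: mem_input => x xl; rewrite !mem_cat xl orbT.
  by move=> j ltj; rewrite /input /= nth_cat ltj.
2: by rewrite size_lev /T4; lia.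
move=> _ [y ->]; apply: runs_const => //=.
apply: (@runs_seq _ _ _ _ (h.+1 * 5).+1 T3 _).
- exact: run_post_levels.
2: lia.
move=> _ <-; do 2!(apply: runs_plus => /=; first lia).
apply: (@runs_seq _ _ _ _ (size ends * 5).+1 T2 _).
- apply: (@run_copy n.+3 ends); [by rewrite size_ends; lia|lia| |].
    by apply: mem_input => x xl; rewrite !mem_cat xl !orbT.
  move=> j ltj; rewrite /input !nth_cat size_lev /=.
  do 2?[case: ifP; try lia].
  by move=> *; congr nth; lia.
2: by rewrite size_ends.
move=> _ [{}y ->]; apply: runs_const => //=; apply: runs_plus => /=; first lia.
rewrite addn0; apply: (@runs_seq _ _ _ _ (h * 11).+1 (3 + T1) _).
- exact: run_post_edges.
2: exact: leqnn.
move=> _ [x11 ->]; do 2!(apply: runs_plus => /=; first lia).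
apply: runs_const => //=.
apply: (@runs_seq _ _ _ _ (n * 11).+1 (3 + T) _); first exact: run_table.
2: rewrite /T1; lia.
move=> _ [x10 [x14 [x15 [mem [-> tab]]]]].
apply: runs_const => //=; apply: runs_plus => /=; first lia.
rewrite addn0; apply: (@runs_seq _ _ _ _ (h.+1 * 32).+1 1 _).
- exact: run_trees tab.
2: by rewrite /T; lia.
by move=> s Ds; apply: runs_skip; rewrite Ds /= -!catA /= addn0.
Qed.

End Reduction.

(** * The graph with posts *)

Section Posts.
Local Open Scope nat_scope.
Variables n h : nat.
Implicit Types (b : bool) (i : 'I_h.+1).

Definition old (v : 'I_n) : 'I_(n + h.+1.*2) := lshift _ v.

Lemma post_subproof b i : i.*2 + b < h.+1.*2.
Proof. by have := ltn_ord i; case: b; lia. Qed.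

(** The sides are interleaved so that one counter running through the levels visits the posts in the
    order of their numbers. *)
Definition post b i : 'I_(n + h.+1.*2) := rshift n (Ordinal (post_subproof b i)).

(** The offset [k] of a post encodes its side as [odd k] and its level as [k./2]; since [k./2 <= h],
    [inord] never falls back to its default. *)
Definition vcase T (f : 'I_n -> T) (g : bool -> 'I_h.+1 -> T) (v : 'I_(n + h.+1.*2)) : T :=
  match fintype.split v with inl w => f w | inr k => g (odd k) (inord k./2) end.

Lemma vcase_old T (f : 'I_n -> T) g v : vcase f g (old v) = f v.
Proof. by rewrite /vcase (unsplitK (inl v)). Qed.

Lemma vcase_post T (f : 'I_n -> T) g b i : vcase f g (post b i) = g b i.
Proof.
rewrite /vcase (unsplitK (inr _)) /=; congr g; first by case: b; lia.
by apply/val_inj; rewrite /= inordK; case: b; have := ltn_ord i; lia.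
Qed.

Variant vertex_spec : 'I_(n + h.+1.*2) -> Prop :=
| VertexOld v : vertex_spec (old v)
| VertexPost b i : vertex_spec (post b i).

Lemma vertexP v : vertex_spec v.
Proof.
rewrite -(splitK v); case: (fintype.split v) => [w|k] /=; first exact: VertexOld.
have -> : k = Ordinal (post_subproof (odd k) (inord k./2)).
  by apply/val_inj; rewrite /= inordK; have := ltn_ord k; lia.
exact: VertexPost.
Qed.

Lemma eq_old u v : (old u == old v) = (u == v).
Proof. exact: eq_lshift. Qed.

Lemma eq_old_post v b i : (old v == post b i) = false.
Proof. exact: eq_lrshift. Qed.

Lemma eq_post_old v b i : (post b i == old v) = false.
Proof. exact: eq_rlshift. Qed.

Lemma eq_post b i c j : (post b i == post c j) = (b == c) && (i == j).
Proof.
apply/eqP/andP => [/rshift_inj[/= E]|[/eqP-> /eqP->] //].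
by split; [move: E; case: b c => -[]; lia|apply/eqP/val_inj => /=; move: E; case: b c => -[]; lia].
Qed.

Definition vertex_eq := (eq_old, eq_old_post, eq_post_old, eq_post).

End Posts.

(** Under the injection into [nat] both sides become [iota 0 (m + k)]. *)
Lemma enum_ord_add m k :
  enum 'I_(m + k) = map (lshift k) (enum 'I_m) ++ map (@rshift m k) (enum 'I_k).
Proof.
have enumE p : map (@nat_of_ord p) (enum 'I_p) = iota 0 p := val_enum_ord p.
apply: (inj_map (@ord_inj _)); rewrite map_cat enumE iotaD.
rewrite -(map_comp _ (lshift k)) -(map_comp _ (@rshift m k)) add0n -[X in _ ++ iota X _]addn0 iotaDl -!enumE -map_comp.
by congr (_ ++ _); apply: eq_map.
Qed.

Lemma flatten_allpairs_bool S T U (f : T -> seq U) (g : S -> bool -> T) (s : seq S) :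
  flatten (map f [seq g x b | x <- s, b <- [:: false; true]]) =
  flatten [seq f (g x false) ++ f (g x true) | x <- s].
Proof. by elim: s => //= x s ->; rewrite catA. Qed.

(** * The T-level graph built from an ordered level graph, its parameters and its encoding *)

Section Construction.
Local Open Scope nat_scope.
Variable G : ordered_level_graph.
Hypothesis width2 : forall i, width (G := G) i <= 2.

Let n := nvert G.
Let h := height G.
Implicit Type b : bool.

Definition post_edge (i : 'I_h) b : 'I_(n + h.+1.*2) * 'I_(n + h.+1.*2) :=
  (post n b (widen_ord (leqnSn h) i), post n b (lift ord0 i)).

Definition old_edge (e : 'I_n * 'I_n) : 'I_(n + h.+1.*2) * 'I_(n + h.+1.*2) :=
  (old h e.1, old h e.2).

Definition post_edges : seq ('I_(n + h.+1.*2) * 'I_(n + h.+1.*2)) :=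
  [seq post_edge i b | i <- enum 'I_h, b <- [:: false; true]].

Definition new_edges := map old_edge (edges G) ++ post_edges.

Definition new_level : 'I_(n + h.+1.*2) -> 'I_h.+1 := vcase (@level G) (fun _ i => i).

Lemma old_edge_inj : injective old_edge.
Proof.
move=> [u v] [u' v'] E; have /lshift_inj /= -> := congr1 fst E.
by have /lshift_inj /= -> := congr1 snd E.
Qed.

Lemma mem_post_edges e : reflect (exists i b, e = post_edge i b) (e \in post_edges).
Proof.
apply: (iffP allpairsP) => [[[i b] [/= _ _ ->]]|[i [b ->]]]; first by exists i, b.
by exists (i, b); split; rewrite ?mem_enum //=; case: b.
Qed.

Lemma mem_new_edges e : e \in new_edges ->
  (exists2 e0, e0 \in edges G & e = old_edge e0) \/ (exists i b, e = post_edge i b).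
Proof.
by rewrite mem_cat => /orP[/mapP|/mem_post_edges]; [left|right].
Qed.

Lemma old_edge_new e : (old_edge e \in new_edges) = (e \in edges G).
Proof.
rewrite mem_cat mem_map; last exact: old_edge_inj.
case: mem_post_edges => [[i [b /(congr1 fst)/eqP]]|]; last by rewrite orbF.
by rewrite eq_old_post.
Qed.

Lemma post_edge_new i b : post_edge i b \in new_edges.
Proof. by rewrite mem_cat; apply/orP; right; apply/mem_post_edges; exists i, b. Qed.

Lemma post_edge_inj i b j c : post_edge i b = post_edge j c -> i = j /\ b = c.
Proof.
move=> /(congr1 fst)/eqP; rewrite eq_post => /andP[/eqP-> /eqP[E]].
by split=> //; apply: val_inj.
Qed.

Lemma new_edges_uniq : uniq new_edges.
Proof.
rewrite cat_uniq map_inj_uniq ?edges_uniq; last exact: old_edge_inj.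
rewrite /=; apply/andP; split.
  apply/hasPn => e /mem_post_edges[i [b ->]]; apply/negP => /mapP[e0 _ /(congr1 fst)/eqP].
  by rewrite eq_post_old.
apply: allpairs_uniq; rewrite ?enum_uniq //.
by move=> [i b] [j c] _ _ /= /post_edge_inj[-> ->].
Qed.

Lemma new_level_surj (i : 'I_h.+1) : exists v, new_level v = i.
Proof. by exists (post n false i); rewrite /new_level vcase_post. Qed.

Lemma new_level_incr e : e \in new_edges -> new_level e.1 < new_level e.2.
Proof.
case/mem_new_edges => [[e0 /level_incr lt0 ->]|[i [b ->]]].
  by rewrite /new_level !vcase_old.
by rewrite /new_level !vcase_post lift0 /=.
Qed.

Definition new_graph : level_graph :=
  LevelGraph new_edges_uniq new_level_surj new_level_incr.

Definition slot (i c : nat) : option 'I_n :=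
  [pick v | (level v == i :> nat) && (chi v == c)].

(** The post is a leaf of every half tree, so no inner node is childless even where the slot is
    empty. *)
Definition half_tree b (i : 'I_h.+1) : rtree 'I_(n + h.+1.*2) :=
  Node (Leaf (post n b i) ::
        if slot i b is Some v then [:: Leaf (old h v)] else [::]).

Definition new_tree (i : 'I_h.+1) : rtree 'I_(n + h.+1.*2) :=
  Node [:: half_tree false i; half_tree true i].

Lemma chi_lt_width (v : 'I_n) : chi v < width (level v).
Proof. by have [+ _ _] := chi_bij (level v); apply. Qed.

Lemma chi_lt2 (v : 'I_n) : chi v < 2.
Proof. exact: leq_trans (chi_lt_width v) _. Qed.

Lemma chi_inj (u v : 'I_n) : level u = level v -> chi u = chi v -> u = v.
Proof.
move=> Euv; have [_ inj _] := chi_bij (level v).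
by apply: inj; apply/mem_set.
Qed.

Lemma slotP i c (v : 'I_n) : slot i c = Some v <-> level v = i :> nat /\ chi v = c.
Proof.
rewrite /slot; case: pickP => [w /andP[/eqP lw /eqP cw]|none].
  split=> [[<-] //|[lv cv]]; congr Some; apply: chi_inj; [apply/val_inj; exact: etrans lw (esym lv)|by rewrite cw cv].
by split=> // -[lv cv]; have := none v; rewrite lv cv !eqxx.
Qed.

Lemma leaves_half_tree b i v :
  (v \in leaves (half_tree b i)) = (v == post n b i) ||
    vcase (fun w => slot i b == Some w) (fun _ _ => false) v.
Proof.
rewrite /half_tree /=; case Dw: (slot i b) => [w|] /=; rewrite !inE.
  by case: (vertexP v) => [u|c j]; rewrite ?vcase_old ?vcase_post ?vertex_eq ?orbF //=; apply/eqP/eqP => [->|[->]].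
by case: (vertexP v) => [u|c j]; rewrite ?vcase_old ?vcase_post ?vertex_eq ?orbF.
Qed.

Lemma leaves_new_tree i :
  leaves (new_tree i) = leaves (half_tree false i) ++ leaves (half_tree true i).
Proof. by rewrite {1}/new_tree /= !cats0. Qed.

Lemma new_tree_inner i : inner_nodes_have_children (new_tree i).
Proof. by rewrite /new_tree /half_tree /=; do 2!case: (slot i _). Qed.

Lemma new_tree_leavesE i v : (v \in leaves (new_tree i)) = (new_level v == i).
Proof.
rewrite leaves_new_tree mem_cat !leaves_half_tree /new_level.
case: (vertexP v) => [w|b j]; rewrite !(vcase_old, vcase_post) !vertex_eq ?orbF /=; last first.
  by case: b; rewrite ?orbF /= ?andbT.
apply/orP/eqP => [[] /eqP/slotP[lw _]|lw]; [exact: val_inj..|].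
have := chi_lt2 w; case Dc: (chi w) => [|[|//]] _; [left|right]; by apply/eqP/slotP; rewrite lw.
Qed.

Lemma new_tree_leaves_uniq i : uniq (leaves (new_tree i)).
Proof.
have half b : uniq (leaves (half_tree b i)).
  by rewrite /half_tree /=; case: (slot i b) => [w|//] /=; rewrite inE vertex_eq.
rewrite leaves_new_tree cat_uniq !half andTb andbT; apply/hasPn => v.
rewrite !leaves_half_tree.
case: (vertexP v) => [w|b j]; rewrite !(vcase_old, vcase_post) !vertex_eq ?orbF /=.
  by move=> /eqP/slotP[lw cw]; apply/negP => /eqP/slotP[_]; rewrite cw.
by case: b.
Qed.

Definition new_T_graph : T_level_graph :=
  @TLevelGraph new_graph new_tree new_tree_inner new_tree_leaves_uniq new_tree_leavesE.

Lemma size_new_tree i :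
  size (leaves (new_tree i)) = 2 + isSome (slot i 0) + isSome (slot i 1).
Proof.
by rewrite leaves_new_tree size_cat /half_tree /=; do 2!case: (slot i _).
Qed.

Lemma width_new_graph i :
  width (G := new_graph) i = size (leaves (new_tree i)).
Proof.
rewrite -(card_uniqP (new_tree_leaves_uniq i)) /width.
by apply: eq_card => v; rewrite [RHS]new_tree_leavesE.
Qed.

(** Some level attains width 2; there [chi] is onto the ranks 0 and 1, so both slots are filled and
    two posts join them. *)
Lemma level_width_new_graph : level_width G = 2 -> level_width new_graph = 4.
Proof.
move=> w2; apply/eqP; rewrite eqn_leq; apply/andP; split.
  apply/bigmax_leqP => i _; rewrite width_new_graph size_new_tree.
  by do 2!case: (slot i _).
have [|i wi] := @bigop.eq_bigmax 'I_h.+1 (@width G); first by rewrite card_ord.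
have {}wi : width (G := G) i = 2 by rewrite -wi.
have full c : c < 2 -> isSome (slot i c).
  move=> ltc; have [_ _ surj] := chi_bij i.
  have [|v lv cv] := surj c; first by rewrite /= wi.
  by have /slotP -> : level v = i :> nat /\ chi v = c by rewrite lv.
apply: leq_trans (leq_bigmax i).
by rewrite width_new_graph size_new_tree !full.
Qed.

Lemma degree_old (v : 'I_n) : degree (G := new_graph) (old h v) = degree v.
Proof.
rewrite /degree count_cat count_map [X in _ + X](_ : _ = 0) ?addn0.
  by apply: eq_count => e /=; rewrite !eq_old.
apply/eqP; rewrite -leqn0 leqNgt -has_count; apply/hasPn => e /mem_post_edges[i [b ->]].
by rewrite /= !eq_post_old.
Qed.

Lemma degree_post b i : degree (G := new_graph) (post n b i) <= 2.
Proof.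
rewrite /degree -size_filter.
(* The candidates are the edges to the neighbours below and above. At an end of the post one
   candidate is a junk pair, which is harmless because only an inclusion is claimed. *)
apply: (@uniq_leq_size _ _ [:: (post n b (inord i.-1), post n b i);
                              (post n b i, post n b (inord i.+1))]).
  by rewrite filter_uniq // new_edges_uniq.
move=> e; rewrite mem_filter => /andP[/= end_e /mem_new_edges[[e0 _ De]|[j [c De]]]].
  by move: end_e; rewrite De /= !eq_old_post.
move: end_e; rewrite De /post_edge /= !eq_post => /orP[] /andP[/eqP-> /eqP Di].
  rewrite !inE; apply/orP; right; apply/eqP; congr (_, post _ _ _); first by rewrite -Di.
  by apply/val_inj; rewrite /= /bump -Di inordK //= ltnS.
rewrite !inE; apply/orP; left; apply/eqP; congr (post _ _ _, _); last by rewrite -Di.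
by apply/val_inj; rewrite /= inordK -Di lift0 //= ltnS ltnW.
Qed.

Lemma max_degree_new_graph : max_degree G = 2 -> max_degree new_graph = 2.
Proof.
move=> d2; apply/eqP; rewrite eqn_leq; apply/andP; split.
  apply/bigmax_leqP => v _; case: (vertexP v) => [w|b i]; last exact: degree_post.
  by rewrite degree_old -d2 (leq_bigmax w).
have n_gt0 : 0 < #|'I_n|.
  by have [v _] := level_surj (l := G) ord0; apply/card_gt0P; exists v.
have [v dv] := bigop.eq_bigmax (@degree G) n_gt0.
by rewrite -d2 /max_degree dv -degree_old (leq_bigmax (old h v)).
Qed.

(** Choosing one vertex per level embeds the [h + 1] levels into the [n] vertices. *)
Lemma lt_height_nvert : h < n.
Proof.
have [f fK] := choice (@level_surj G).
have f_inj : injective f by exact: can_inj fK.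
by have := leq_card f f_inj; rewrite !card_ord.
Qed.

Definition slot_code i c : nat := if slot i c is Some v then v.+1 else 0.

Lemma encode_half_tree b (i : 'I_h.+1) :
  encode_tree (half_tree b i) = half_tree_code (n + i.*2 + b) (slot_code i b).
Proof.
by rewrite /half_tree /slot_code /=; case: (slot i b) => [v|] /=; rewrite addnA.
Qed.

Lemma map_enum_mkseq (T : Type) (f : nat -> T) k :
  [seq f (nat_of_ord i) | i <- enum 'I_k] = mkseq f k.
Proof. by rewrite /mkseq -val_enum_ord -map_comp. Qed.

(** The post with offset [k] lies on level [k./2], so this computes the levels of the posts in the
    order of their numbers. *)
Lemma map_half_iota k : map half (iota 0 k.*2) = flatten (mkseq (fun i => [:: i; i]) k).
Proof.
elim: k => // k IHk; rewrite mkseqS flatten_rcons -IHk doubleS -addn2 iotaD map_cat add0n /=.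
by congr (_ ++ [:: _; _]); lia.
Qed.

Lemma encode_new_levels :
  [seq nat_of_ord (new_level v) | v <- enum 'I_(n + h.+1.*2)] =
  [seq nat_of_ord (level v) | v <- enum 'I_n] ++
  flatten (mkseq (fun i => [:: i; i]) h.+1).
Proof.
rewrite enum_ord_add map_cat -(map_comp _ (lshift _)) -(map_comp _ (@rshift n _)); congr (_ ++ _).
  by apply: eq_map => v /=; rewrite -[lshift _ v]/(old h v) /new_level vcase_old.
rewrite -map_half_iota -val_enum_ord -map_comp; apply: eq_map => k /=.
have Dk : k = Ordinal (post_subproof (odd k) (inord k./2 : 'I_h.+1)).
  by apply/val_inj; rewrite /= inordK; have := ltn_ord k; lia.
rewrite {1}Dk -[rshift _ _]/(post n (odd k) (inord k./2)) /new_level vcase_post.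
by rewrite inordK //; have := ltn_ord k; lia.
Qed.

Lemma encode_new_edges :
  flatten [seq [:: nat_of_ord e.1; nat_of_ord e.2] | e <- new_edges] =
  flatten [seq [:: nat_of_ord e.1; nat_of_ord e.2] | e <- edges G] ++
  flatten (mkseq (fun i => [:: n + i.*2; n + i.*2.+2; n + i.*2.+1; n + i.*2.+3]) h).
Proof.
rewrite map_cat flatten_cat -map_comp; congr (_ ++ _).
rewrite flatten_allpairs_bool -map_enum_mkseq; congr flatten; apply: eq_map => i.
by rewrite /= /bump /=; congr [:: _; _; _; _]; lia.
Qed.

Lemma size_new_edges : size new_edges = size (edges G) + h.*2.
Proof. by rewrite size_cat size_map size_allpairs size_enum_ord muln2. Qed.

Lemma encode_new_T_graph :
  encode_T new_T_graph = [:: n + h.+1.*2; h; size (edges G) + h.*2]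
    ++ [seq nat_of_ord (level v) | v <- enum 'I_n]
    ++ flatten (mkseq (fun i => [:: i; i]) h.+1)
    ++ flatten [seq [:: nat_of_ord e.1; nat_of_ord e.2] | e <- edges G]
    ++ flatten (mkseq (fun i => [:: n + i.*2; n + i.*2.+2; n + i.*2.+1; n + i.*2.+3]) h)
    ++ flatten (mkseq (fun i => 2 ::
         half_tree_code (n + i.*2) (slot_code i 0) ++
         half_tree_code (n + i.*2.+1) (slot_code i 1)) h.+1).
Proof.
rewrite /encode_T /encode_graph [edges _]/= [level (l := _)]/= [nvert _]/= [height _]/=.
rewrite encode_new_levels encode_new_edges size_new_edges -!catA.
do 6!congr (_ ++ _).
congr flatten; rewrite -[RHS]map_enum_mkseq; apply: eq_map => i.
have -> : encode_tree (new_tree i) =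
    2 :: encode_tree (half_tree false i) ++ encode_tree (half_tree true i).
  by rewrite {1}/new_tree [LHS]/= cats0.
by rewrite !encode_half_tree addn0 addn1 addnS.
Qed.

Lemma linear_time_reduction :
  computes_in_linear_time reduction 100 (encode_ordered G) (encode_T new_T_graph).
Proof.
pose lev := [seq nat_of_ord (level v) | v <- enum 'I_n].
pose ends := flatten [seq [:: nat_of_ord e.1; nat_of_ord e.2] | e <- edges G].
pose ords := [seq chi v | v <- enum 'I_n].
pose m := size (edges G).
have size_lev : size lev = n by rewrite size_map size_enum_ord.
have size_ords : size ords = n by rewrite size_map size_enum_ord.
have size_ends : size ends = m + m.
  by rewrite /ends /m; elim: (edges G) => //= e s ->; rewrite addnS.
have Dinput : encode_ordered G = [:: n; h; m] ++ lev ++ ends ++ ords.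
  by rewrite /encode_ordered /encode_graph -!catA.
have nth_lev (v : 'I_n) : nth 0 lev v = level v.
  by rewrite (nth_map v) ?size_enum_ord // nth_ord_enum.
have nth_ords (v : 'I_n) : nth 0 ords v = chi v.
  by rewrite (nth_map v) ?size_enum_ord // nth_ord_enum.
have Dsize : size (encode_ordered G) = (n + m + m + n).+3.
  by rewrite Dinput !size_cat size_lev size_ends size_ords /=; lia.
have [|||||||t [s [run le_t Ds]]] :=
  @run_reduction (100 * size (encode_ordered G)) n h m lev ends ords slot_code
    size_lev size_ends size_ords.
- by move=> _ /mapP[v _ ->]; have := ltn_ord (level v); rewrite ltnS.
- by move=> x /flattenP[_ /mapP[e _ ->]]; rewrite !inE => /orP[] /eqP ->.
- by move=> _ /mapP[v _ ->]; exact: chi_lt2.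
- exact: lt_height_nvert.
- by rewrite Dsize leq_mul2r.
- move=> k ltk; pose v := Ordinal ltk.
  rewrite -[k]/(nat_of_ord v) nth_lev nth_ords /slot_code.
  by have /slotP -> : level v = level v :> nat /\ chi v = chi v.
- move=> i c k; rewrite /slot_code; case Dv: (slot i c) => [v|//] [<-].
  by move/slotP: Dv; rewrite nth_lev nth_ords => -[-> ->].
exists t, s; split; [by rewrite {2}Dinput|by rewrite Dsize|by rewrite encode_new_T_graph].
Qed.

End Construction.

(** * Upward curves *)

Section Curves.
Local Open Scope classical_set_scope.
Local Open Scope ring_scope.
Variable R : realType.
Implicit Types (c d : R -> R * R) (p q : R * R).

(** Meant for a reparametrised curve, where both the parameter change and the curve are continuous
    only on the segment. *)
Lemma within_comp (S T U : topologicalType) (A : set S) (B : set T) (f : S -> T) (g : T -> U) :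
  {within A, continuous f} -> {within B, continuous g} -> (forall x, A x -> B (f x)) ->
  {within A, continuous (g \o f)}.
Proof.
move=> /subspace_continuousP cf /subspace_continuousP cg AB; apply/subspace_continuousP => x Ax.
apply: (@cvg_comp _ _ _ f g _ (within B (nbhs (f x)))); last by apply: cg; apply: AB.
move=> W /(cf x Ax); rewrite /= /nbhs /= /within /=.
by apply: filterS => y Wy Ay; apply: Wy => //; apply: AB.
Qed.

Lemma within_fst (T : topologicalType) (A : set T) (f : T -> R * R) :
  {within A, continuous f} -> {within A, continuous (fst \o f)}.
Proof. by move=> cf; apply: within_continuous_comp cf => x _; exact: cvg_fst. Qed.

Lemma within_snd (T : topologicalType) (A : set T) (f : T -> R * R) :
  {within A, continuous f} -> {within A, continuous (snd \o f)}.
Proof. by move=> cf; apply: within_continuous_comp cf => x _; exact: cvg_snd. Qed.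

Lemma upward_le c p q s t : upward_curve c p q ->
  0 <= s <= 1 -> 0 <= t <= 1 -> ((c s).2 <= (c t).2) = (s <= t).
Proof.
move=> [_ _ _ up] /andP[s0 s1] /andP[t0 t1].
have [st|ts|->] := ltgtP s t; last by rewrite lexx.
  by rewrite ltW // up.
by apply/negbTE; rewrite -ltNge up.
Qed.

Lemma upward_height c p q t : upward_curve c p q -> 0 <= t <= 1 -> p.2 <= (c t).2 <= q.2.
Proof.
move=> cpq t01; have [_ <- <- _] := cpq.
by rewrite !(upward_le cpq) ?lexx ?ler01 //=.
Qed.

Lemma upward_reaches c p q y : upward_curve c p q -> p.2 <= y <= q.2 ->
  exists t, 0 <= t <= 1 /\ (c t).2 = y.
Proof.
move=> [cc <- <- up] y01; have [|t] := @IVT _ (snd \o c) 0 1 y ler01 (within_snd cc).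
- by rewrite /= (min_idPl _) ?(max_idPr _) // ltW // up.
- by rewrite in_itv /= => t01 <-; exists t.
Qed.

(* Both curves are graphs over the common interval of heights; at a height
   where the difference of their x-coordinates vanished they would meet. *)
Lemma disjoint_upward_curves_order c d p q p' q' :
  upward_curve c p q -> upward_curve d p' q' -> p.2 = p'.2 -> q.2 = q'.2 ->
  (forall z, on_curve c z -> on_curve d z -> False) -> p.1 < p'.1 -> q.1 < q'.1.
Proof.
move=> cpq dpq Ep Eq disj lt_p.
(* The parameter change [s] aligns heights: [d] at [s t] is exactly as high as [c] at [t]. *)
have [s sP] : exists s : R -> R, forall t, 0 <= t <= 1 -> 0 <= s t <= 1 /\ (d (s t)).2 = (c t).2.
  suff /choice[s sP] : forall t, exists u, 0 <= t <= 1 -> 0 <= u <= 1 /\ (d u).2 = (c t).2.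
    by exists s.
  move=> t; case: (boolP (0 <= t <= 1)) => [t01|]; last by exists 0.
  have := upward_height cpq t01; rewrite Ep Eq => /(upward_reaches dpq)[u uP].
  by exists u.
have [s01 sE] : (forall t, 0 <= t <= 1 -> 0 <= s t <= 1) /\
    (forall t, 0 <= t <= 1 -> (d (s t)).2 = (c t).2).
  by split=> t /sP[].
have s_le t u : 0 <= t <= 1 -> 0 <= u <= 1 -> (s t <= s u) = (t <= u).
  by move=> t01 u01; rewrite -(upward_le dpq (s01 _ t01) (s01 _ u01)) !sE // (upward_le cpq).
have b0 : 0 <= (0 : R) <= 1 by rewrite lexx ler01.
have b1 : 0 <= (1 : R) <= 1 by rewrite lexx ler01.
have [cc c0 c1 _] := cpq; have [cd d0 d1 _] := dpq.
have s0 : s 0 = 0.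
  apply/eqP; rewrite eq_le; apply/andP; split; last by case/andP: (s01 _ b0).
  by rewrite -(upward_le dpq (s01 _ b0) b0) sE // c0 d0 Ep.
have s1 : s 1 = 1.
  apply/eqP; rewrite eq_le; apply/andP; split; first by case/andP: (s01 _ b1).
  by rewrite -(upward_le dpq b1 (s01 _ b1)) sE // c1 d1 Eq.
(* An increasing map of the segment onto itself has no jumps. *)
have cs : {within `[0, 1], continuous s}.
  apply: segment_inc_surj_continuous.
    by move=> t u; rewrite !in_itv /=; exact: s_le.
  move=> u; rewrite s0 s1 /= in_itv /= => u01.
  have := upward_height dpq u01; rewrite -Ep -Eq => /(upward_reaches cpq)[t [t01 ct]].
  exists t; first by rewrite /= in_itv.
  apply/eqP; rewrite eq_le -(upward_le dpq (s01 _ t01) u01).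
  by rewrite -(upward_le dpq u01 (s01 _ t01)) sE // ct lexx.
pose f := (fst \o (d \o s)) - (fst \o c).
have cf : {within `[0, 1], continuous f}.
  apply: within_continuousB; apply: within_fst => //.
  by apply: (within_comp cs cd) => t; rewrite /= !in_itv; exact: s01.
have fE t : f t = (d (s t)).1 - (c t).1 by [].
have f0 : 0 < f 0 by rewrite fE s0 c0 d0 subr_gt0.
rewrite -subr_gt0 -d1 -c1 -{1}s1 -fE ltNge; apply/negP => f1.
have [|t] := @IVT _ f 0 1 0 ler01 cf.
  have f10 : f 1 <= f 0 by exact: le_trans f1 (ltW f0).
  by rewrite (min_idPr f10) (max_idPl f10) f1 ltW.
rewrite in_itv /= => t01 /eqP; rewrite fE subr_eq0 => /eqP ft.
apply: (disj (c t)); first by exists t; case/andP: t01.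
exists (s t); case/andP: (s01 _ t01) => ? ?; split=> //.
by rewrite [LHS]surjective_pairing [RHS]surjective_pairing ft sE.
Qed.

Lemma curve_bounded c : {within `[0, 1], continuous c} ->
  exists M, forall t, 0 <= t <= 1 -> `|(c t).1| <= M.
Proof.
move=> /within_fst cc.
have cn : {within `[0, 1], continuous (Num.norm \o (fst \o c))}.
  by apply: within_continuous_comp cc => x _; exact: norm_continuous.
have [t _ tP] := EVT_max (@ler01 R) cn.
by exists `|(c t).1| => u u01; apply: tP; rewrite in_itv.
Qed.

(** The bound [1 < M] keeps lines at abscissae [-M] and [M] clear of vertices at 0 and 1 as well,
    including isolated ones, which no curve controls. *)
Lemma curves_bounded (I : eqType) (s : seq I) (c : I -> R -> R * R) :
  (forall i, i \in s -> {within `[0, 1], continuous (c i)}) ->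
  exists2 M, 1 < M & forall i t, i \in s -> 0 <= t <= 1 -> `|(c i t).1| < M.
Proof.
elim: s => [_|i s IHs cs]; first by exists 2; rewrite // ltr1n.
have [|M M1 MP] := IHs; first by move=> j js; apply: cs; rewrite inE js orbT.
have [|N NP] := @curve_bounded (c i); first by apply: cs; rewrite inE eqxx.
exists (Num.max M (N + 1)); first by rewrite lt_max M1.
move=> j t; rewrite inE lt_max => /orP[/eqP->|js] t01; last by rewrite MP.
by apply/orP; right; rewrite (le_lt_trans (NP _ t01)) ?ltrDl ?ltr01.
Qed.

Lemma vertical_upward (x y : R) :
  upward_curve (fun t => (x, y + t)) (x, y) (x, y + 1).
Proof.
split=> //; first 1 last; first by rewrite addr0.
  by move=> s t _ st _ /=; rewrite ltrD2l.
apply: continuous_subspaceT => t; apply: (cvg_pair (G := nbhs x) (H := nbhs (y + t))); first exact: cvg_cst.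
by apply: cvgD; [exact: cvg_cst|exact: cvg_id].
Qed.

(** The tent function, whose integer translates are the basis of piecewise linear interpolation;
    being nonnegative, it preserves a common sign of the interpolated values. *)
Let hat (t : R) : R := Num.max 0 (1 - `|t|).

Lemma continuous_hat (a : R) : continuous (fun t => hat (t - a)).
Proof.
move=> t; apply: (@continuous_max _ _ (fun=> 0) (fun t => 1 - `|t - a|)); first exact: cvg_cst.
apply: cvgB; first exact: cvg_cst.
by apply: cvg_norm; apply: cvgB; [exact: cvg_id|exact: cvg_cst].
Qed.

Lemma hat_nat (i j : nat) : hat (i%:R - j%:R) = (i == j)%:R.
Proof.
rewrite /hat; have [->|ne] := eqVneq i j.
  by rewrite subrr normr0 subr0 (max_idPr _) ?ler01.
apply/max_idPl; rewrite subr_le0.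
wlog lt : i j ne / (j < i)%N.
  move=> H; move: (ne); rewrite neq_ltn => /orP[lt|lt]; last exact: H.
  by rewrite distrC; apply: H; rewrite // eq_sym.
rewrite -natrB 1?ltnW // normr_nat ler1n subn_gt0 //.
Qed.

Definition interpolate h (a : 'I_h.+1 -> R) (y : R) : R := \sum_i a i * hat (y - i%:R).

Lemma interpolate_nat h (a : 'I_h.+1 -> R) (i : 'I_h.+1) : interpolate a i%:R = a i.
Proof.
rewrite /interpolate (bigD1 i) //= hat_nat eqxx mulr1 big1 ?addr0 // => j ne.
rewrite hat_nat; suff -> : (i == j :> nat) = false by rewrite mulr0.
by rewrite eq_sym; apply: negbTE ne.
Qed.

Lemma continuous_interpolate h (a : 'I_h.+1 -> R) : continuous (interpolate a).
Proof.
rewrite /interpolate; apply: continuous_big => [|i _ t]; first exact: add_continuous.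
by apply: cvgM; [exact: cvg_cst|exact: continuous_hat].
Qed.

(** After multiplication by [s] no summand is negative, and the one at the integer part of [y] is
    positive because [y] is less than 1 above it. *)
Lemma interpolate_neq0 h (a : 'I_h.+1 -> R) (s y : R) :
  (forall i, 0 < s * a i) -> 0 <= y <= h%:R -> interpolate a y != 0.
Proof.
move=> sa /andP[y0 yh].
suff : 0 < s * interpolate a y by case: eqP => // ->; rewrite mulr0 ltxx.
have hat_ge0 t : 0 <= hat t by rewrite le_max lexx.
have /andP[le_y lt_y] := truncn_itv y0.
have lt_h : (Num.truncn y < h.+1)%N by rewrite -(ltr_nat R) (le_lt_trans le_y) // (le_lt_trans yh) // ltr_nat.
rewrite /interpolate mulr_sumr (bigD1 (Ordinal lt_h)) //=.
apply: ltr_pwDl; last by apply: sumr_ge0 => i _; rewrite mulrA mulr_ge0 // ltW.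
rewrite mulrA mulr_gt0 // lt_max; apply/orP; right.
by rewrite ger0_norm ?subr_ge0 // subr_gt0 ltrBlDl natr1.
Qed.

End Curves.

(** * Drawings *)

Section Drawings.
Local Open Scope classical_set_scope.
Local Open Scope ring_scope.
Variables (R : realType) (G : ordered_level_graph).
Hypothesis width2 : forall i, (width (G := G) i <= 2)%N.

Let n := nvert G.
Let h := height G.
Let H := new_graph G.

Lemma level_old (v : 'I_n) : level (l := H) (old h v) = level v.
Proof. exact: vcase_old. Qed.

Lemma level_post b i : level (l := H) (post n b i) = i.
Proof. exact: vcase_post. Qed.

Lemma is_end_old (v : 'I_n) e : is_end (old h v) (old_edge e) = is_end v e.
Proof. by rewrite /is_end /old_edge /= !eq_old. Qed.

Lemma post_end_old b i e : is_end (post n b i) (old_edge (G := G) e) = false.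
Proof. by rewrite /is_end /old_edge /= !eq_post_old. Qed.

Lemma old_end_post (v : 'I_n) i b : is_end (old h v) (post_edge (G := G) i b) = false.
Proof. by rewrite /is_end /post_edge /= !eq_old_post. Qed.

Lemma post_end_post b i j c :
  is_end (post n b i) (post_edge (G := G) j c) =
  (b == c) && ((i == j :> nat) || (i == j.+1 :> nat)).
Proof. by rewrite /is_end /post_edge /= !eq_post -!val_eqE /= /bump; case: eqP. Qed.

Lemma subtrees_new_tree i u : List.In u (subtrees (new_tree (G := G) i)) ->
  [\/ u = new_tree i, exists b, u = half_tree b i | exists v, u = Leaf v].
Proof.
move=> u_in.
have [<-|{}u_in] : new_tree i = u \/
    List.In u (subtrees (half_tree false i) ++ subtrees (half_tree true i) ++ [::])%SEQ.
- exact: u_in.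
- exact: Or31.
have [b {u_in}] : exists b, List.In u (subtrees (half_tree (G := G) b i)).
  move: u_in; rewrite cats0 => u_in.
  by have [?|?] := List.in_app_or (subtrees (half_tree false i)) _ _ u_in; [exists false|exists true].
rewrite /half_tree /=; case=> [<-|]; first by apply: Or32; exists b.
case=> [<-|]; first by apply: Or33; exists (post n b i).
by case: slot => [v /= [<-|]|] //; apply: Or33; exists (old h v).
Qed.

(** * From an ordered drawing to a T-level planar drawing *)

Section Forward.
Variables (D : drawing R G) (M : R).
Hypothesis D_planar : level_planar D.
Hypothesis D_chi : forall v, xcoord D v = (chi v)%:R.
Hypothesis M_gt1 : 1 < M.
Hypothesis curve_lt_M : forall e t, e \in edges G -> 0 <= t <= 1 -> `|(curve D e t).1| < M.

Let side (b : bool) : R := if b then M else - M.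

(** A pair starting at a post gets the vertical unit segment above it. Pairs from an old vertex to a
    post are no edges and receive a dummy curve. *)
Definition extended_drawing : drawing R H := @Drawing R H
  (vcase (xcoord D) (fun b _ => side b))
  (fun e => vcase (fun u => vcase (fun v => curve D (u, v)) (fun _ _ _ => (0, 0)) e.2)
                  (fun b i t => (side b, i%:R + t)) e.1).
Let D' := extended_drawing.

Lemma position_old v : position D' (old h v) = position D v.
Proof. by rewrite /position level_old /= vcase_old. Qed.

Lemma position_post b i : position D' (post n b i) = (side b, i%:R).
Proof. by rewrite /position level_post /= vcase_post. Qed.

Lemma curve_old e : curve D' (old_edge e) = curve D e.
Proof. by rewrite /= !vcase_old -surjective_pairing. Qed.

Lemma curve_post i b : curve D' (post_edge i b) = fun t => (side b, (i : nat)%:R + t).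
Proof. by rewrite /= vcase_post. Qed.

Lemma norm_side b : `|side b| = M.
Proof.
have M0 : 0 <= M by rewrite ltW // (lt_trans ltr01).
by case: b; rewrite /= ?normrN ger0_norm.
Qed.

Lemma side_inj : injective side.
Proof. by have := M_gt1; move=> M1 [] [] //= E; exfalso; lra. Qed.

Lemma norm_xcoord_lt v : `|xcoord D v| < M.
Proof.
rewrite D_chi normr_nat (le_lt_trans _ M_gt1) // lern1.
by rewrite -ltnS (chi_lt2 width2).
Qed.

Lemma side_not_on_old e b y : e \in edges G -> ~ on_curve (curve D e) (side b, y).
Proof.
move=> eG [t [t0 t1 E]]; have := curve_lt_M eG (t := t).
by rewrite t0 t1 E norm_side ltxx => /(_ isT).
Qed.

Lemma on_post i b p : on_curve (curve D' (post_edge i b)) p ->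
  p.1 = side b /\ (i : nat)%:R <= p.2 <= (i : nat)%:R + 1.
Proof. by rewrite curve_post => -[t [t0 t1 <-]] /=; split=> //; lra. Qed.

Lemma extended_planar : level_planar D'.
Proof.
split.
- move=> u v; case: (vertexP u) => [u'|b i]; case: (vertexP v) => [v'|c j];
    rewrite ?position_old ?position_post.
  + by move/(vertices_distinct D_planar) ->.
  + by case=> E _; have := norm_xcoord_lt u'; rewrite E norm_side ltxx.
  + by case=> E _; have := norm_xcoord_lt v'; rewrite -E norm_side ltxx.
  + by case=> /side_inj -> /eqP; rewrite eqr_nat => /eqP/val_inj ->.
- move=> e /mem_new_edges[[e0 e0G ->]|[i [b ->]]].
    rewrite curve_old !position_old; exact: edges_upward D_planar _ e0G.
  rewrite curve_post !position_post lift0 -natr1; exact: vertical_upward.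
- move=> e v /mem_new_edges[[e0 e0G ->]|[i [b ->]]].
    rewrite curve_old; case: (vertexP v) => [w|b i]; rewrite ?position_old ?position_post.
      by rewrite is_end_old; apply: edges_avoid_vertices.
    by move/side_not_on_old; case.
  move/on_post; case: (vertexP v) => [w|c j]; rewrite ?position_old ?position_post.
    by case=> /= E _; have := norm_xcoord_lt w; rewrite E norm_side ltxx.
  case=> /= /side_inj ->; rewrite natr1 !ler_nat post_end_post eqxx /=; lia.
(* A common point forces the same side and [j <= i + 1], so distinct edges are consecutive and meet
   exactly at the post vertex of level [j]. The case [j < i] follows by symmetry. *)
- have post_post i b j c p : post_edge i b <> post_edge j c ->
      on_curve (curve D' (post_edge i b)) p -> on_curve (curve D' (post_edge j c)) p ->
      (i <= j)%N -> exists v,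
      [/\ is_end v (post_edge (G := G) i b), is_end v (post_edge (G := G) j c)
        & p = position D' v].
    move=> ne /on_post[pb /andP[_ pi]] /on_post[pc /andP[pj _]] le_ij.
    have Ebc : b = c by apply: side_inj; rewrite -pb.
    have lt_ij : (i < j)%N.
      rewrite ltn_neqAle le_ij andbT; apply/eqP => /val_inj Eij.
      by apply: ne; rewrite Eij Ebc.
    have Eji : (j = i.+1 :> nat)%N.
      by apply/eqP; rewrite eqn_leq lt_ij andbT -(ler_nat R) -natr1 (le_trans pj).
    have lt_jh : (j < h.+1)%N by rewrite ltnS ltnW.
    exists (post n b (Ordinal lt_jh)).
    split; [by rewrite post_end_post eqxx /= Eji eqxx orbT|by rewrite post_end_post Ebc !eqxx|].
    rewrite position_post /= Eji [LHS]surjective_pairing pc; congr pair; first by rewrite Ebc.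
    by apply/eqP; rewrite eq_le -natr1 pi natr1 -Eji.
  move=> e f p /mem_new_edges[[e0 e0G ->]|[i [b ->]]] /mem_new_edges[[f0 f0G ->]|[j [c ->]]] ne.
  + rewrite !curve_old => oe of_.
    have [|v [ve vf ->]] := edges_crossing_free D_planar e0G f0G _ oe of_.
      by move=> E; apply: ne; rewrite E.
    by exists (old h v); rewrite !is_end_old position_old.
  + rewrite curve_old => oe /on_post[pc _]; case: (side_not_on_old (b := c) (y := p.2) e0G).
    by rewrite -pc -surjective_pairing.
  + rewrite curve_old => /on_post[pc _] oe; case: (side_not_on_old (b := b) (y := p.2) f0G).
    by rewrite -pc -surjective_pairing.
  + move=> oe of_; case/orP: (leq_total i j) => le; first exact: post_post.
    by have [|v [? ? ?]] := post_post j c i b p _ of_ oe le; [exact: nesym|exists v].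
Qed.

(** The gap between 0 and 1 separates the two half trees on every level, which makes each of them
    consecutive. *)
Lemma xcoord_half b i v : v \in leaves (half_tree (G := G) b i) ->
  if b then 1 <= xcoord D' v else xcoord D' v <= 0.
Proof.
have M0 : - M <= 0 by rewrite oppr_le0 ltW // (lt_trans ltr01).
rewrite leaves_half_tree; case: (vertexP v) => [w|c j]; rewrite vertex_eq.
  rewrite /= !vcase_old => /eqP/slotP[_ cw]; rewrite D_chi cw.
  by case: b {cw}; rewrite lexx.
rewrite vcase_post orbF /= vcase_post => /andP[/eqP -> _].
by case: b; rewrite //= ltW.
Qed.

Lemma extended_T_planar : T_level_planar R (new_T_graph width2).
Proof.
exists D'; split; first exact: extended_planar.
move=> i u /= u_in a b c a_u b_u ci ac cb.
have : c \in leaves (new_tree i) by rewrite (new_tree_leavesE width2); apply/eqP.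
case/subtrees_new_tree: u_in a_u b_u => [-> //|[d ->] a_u b_u|[v ->]]; last first.
  rewrite !inE => /eqP Ea /eqP Eb; move: ac cb.
  by rewrite Ea Eb => ac /(lt_trans ac); rewrite ltxx.
rewrite leaves_new_tree mem_cat; have := xcoord_half a_u; have := xcoord_half b_u.
case: d {a_u b_u} => xb xa /orP[] // /xcoord_half /= xc; exfalso.
  by have := le_lt_trans xa (lt_le_trans ac xc); rewrite ltr10.
by have := le_lt_trans xc (lt_le_trans cb xb); rewrite ltr10.
Qed.

End Forward.

(** * From a T-level planar drawing to an ordered drawing *)

Section Backward.
Variable D : drawing R H.
Hypothesis D_planar : level_planar D.
Hypothesis D_consecutive : forall (i : 'I_h.+1) u, List.In u (subtrees (new_tree i)) ->
  forall a b c, a \in leaves u -> b \in leaves u -> level (l := H) c = i ->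
    xcoord D a < xcoord D c -> xcoord D c < xcoord D b -> c \in leaves u.

Lemma xcoord_neq u v : level (l := H) u = level v -> u != v -> xcoord D u != xcoord D v.
Proof.
move=> Euv; apply: contraNN => /eqP xuv; apply/eqP/(vertices_distinct D_planar).
by rewrite /position Euv xuv.
Qed.

(** Edges of different posts share no endpoint, so planarity makes their curves disjoint and the
    order at the bottom persists at the top. *)
Lemma post_order_step (i : 'I_h) b :
  xcoord D (post_edge i b).1 < xcoord D (post_edge i (~~ b)).1 ->
  xcoord D (post_edge i b).2 < xcoord D (post_edge i (~~ b)).2.
Proof.
have up c := edges_upward D_planar (post_edge_new i c).
apply: (disjoint_upward_curves_order (up b) (up (~~ b))).
- by rewrite /= /new_level !vcase_post.
- by rewrite /= /new_level !vcase_post.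
- move=> z zb znb; have ne : post_edge (G := G) i b <> post_edge i (~~ b).
    by move/post_edge_inj => -[_]; case: b {zb znb}.
  have [v []] := edges_crossing_free D_planar (post_edge_new i b) (post_edge_new i (~~ b)) ne zb znb.
  case: (vertexP v) => [w|c j]; first by rewrite old_end_post.
  by rewrite !post_end_post => /andP[/eqP -> _]; case: b {zb znb ne}.
Qed.

(** The boolean [s] records the reflection: it names the post that is on the left at level 0 and
    hence everywhere. *)
Lemma post_order : exists s, forall i : 'I_h.+1,
  xcoord D (post n s i) < xcoord D (post n (~~ s) i).
Proof.
have [s s0] : exists s, xcoord D (post n s (ord0 : 'I_h.+1)) < xcoord D (post n (~~ s) ord0).
  have [lt|lt|E] := ltgtP (xcoord D (post n false ord0)) (xcoord D (post n true (ord0 : 'I_h.+1))).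
  - by exists false.
  - by exists true.
  - have := @xcoord_neq (post n false ord0) (post n true (ord0 : 'I_h.+1)).
    by rewrite !level_post E eqxx eq_post => /(_ erefl isT).
exists s => -[k lt_k]; elim: k lt_k => [|k IHk] lt_k.
  by rewrite (_ : Ordinal lt_k = ord0) //; apply/val_inj.
have lt_kh : (k < h)%N by [].
have := post_order_step (i := Ordinal lt_kh) (b := s).
rewrite /post_edge /= (_ : lift _ _ = Ordinal lt_k); last by apply/val_inj.
by apply; rewrite (_ : widen_ord _ _ = Ordinal (ltnW lt_k)) //; apply/val_inj.
Qed.

(** The half trees of a level have disjoint leaf sets, so such a [c] would violate consecutiveness
    at the root of the other half. *)
Lemma half_not_between (i : 'I_h.+1) b a c d :
  a \in leaves (half_tree b i) -> d \in leaves (half_tree b i) ->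
  c \in leaves (half_tree (~~ b) i) ->
  xcoord D a < xcoord D c -> xcoord D c < xcoord D d -> False.
Proof.
move=> ain din cin ac cd.
have ci : level (l := H) c = i.
  apply/eqP; rewrite -[_ == _](new_tree_leavesE width2) leaves_new_tree mem_cat.
  by case: b cin {ain din} => ->; rewrite ?orbT.
have b_in : List.In (half_tree b i) (subtrees (new_tree i)).
  right; case: b {ain din cin}; last by left.
  have := List.in_or_app (subtrees (half_tree false i)) (subtrees (half_tree true i) ++ [::])%SEQ.
  by apply; right; left.
have := D_consecutive b_in ain din ci ac cd; move: cin.
rewrite !leaves_half_tree; case: (vertexP c) => [w|e j]; rewrite !vertex_eq.
  by rewrite !vcase_old /= => /eqP/slotP[_ +] /eqP/slotP[_ cw]; rewrite cw; case: (b).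
by rewrite !vcase_post !orbF => /andP[/eqP -> _] /andP[]; case: (b).
Qed.

Lemma slot_order (i : 'I_h.+1) s u v : xcoord D (post n s i) < xcoord D (post n (~~ s) i) ->
  slot G i s = Some u -> slot G i (~~ s) = Some v -> xcoord D (old h u) < xcoord D (old h v).
Proof.
move=> lt_s Du Dv.
have u_in : old h u \in leaves (half_tree s i).
  by rewrite leaves_half_tree vcase_old Du eqxx orbT.
have v_in : old h v \in leaves (half_tree (~~ s) i).
  by rewrite leaves_half_tree vcase_old Dv eqxx orbT.
have p_in b : post n b i \in leaves (half_tree b i) by rewrite leaves_half_tree eqxx.
have /slotP[lu cu] := Du; have /slotP[lv cv] := Dv.
have {}lu : level u = i := val_inj lu; have {}lv : level v = i := val_inj lv.
have neq_uv : xcoord D (old h v) != xcoord D (old h u).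
  apply: xcoord_neq; first by rewrite !level_old lu lv.
  by rewrite eq_old; apply: contraTneq isT => E; move: cu cv; rewrite E => ->; case: (s).
have neq_vp : xcoord D (old h v) != xcoord D (post n s i).
  by apply: xcoord_neq; rewrite ?level_old ?level_post ?lv // eq_old_post.
(* Suppose [v] is left of [u]. If [v] is also left of the post of [u], that post separates [v] from
   its own post; otherwise [v] separates [u] from the post of [u]. *)
rewrite ltNge le_eqVlt (negbTE neq_uv); apply/negP => lt_vu.
case: ltgtP neq_vp => // lt_vp _.
  by apply: (@half_not_between i (~~ s)) lt_vp lt_s; rewrite ?negbK.
exact: (half_not_between (p_in s) u_in v_in).
Qed.

Lemma level_scaling (s : bool) (i : 'I_h.+1) :
  xcoord D (post n s i) < xcoord D (post n (~~ s) i) ->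
  exists ab : R * R, 0 < (-1) ^+ s * ab.1 /\
    forall v, level v = i -> ab.1 * xcoord D (old h v) + ab.2 = (chi v)%:R.
Proof.
move=> lt_s; pose x v := xcoord D (old h v).
have sign_sq : 0 < (-1) ^+ s * (-1) ^+ s :> R by rewrite -expr2 sqrr_sign.
have find v : level v = i -> slot G i (chi v) = Some v by move=> <-; apply/slotP.
have chi01 (v : 'I_n) : chi v = 0%N \/ chi v = 1%N.
  by have := chi_lt2 width2 v; case: (chi v) => [|[|]]; auto.
case D0: (slot G i 0) => [u|].
  case D1: (slot G i 1) => [v|].
    have sd : 0 < (-1) ^+ s * (x v - x u).
      case: s lt_s {sign_sq} => lt_s; rewrite ?expr1 ?expr0 ?mulN1r ?mul1r ?opprB subr_gt0.
        exact: slot_order lt_s D1 D0.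
      exact: slot_order lt_s D0 D1.
    have d0 : x v - x u != 0 by apply: contraTneq sd => ->; rewrite mulr0 ltxx.
    (* The affine map sending [x u] to 0 and [x v] to 1; its slope has the sign of [x v - x u]. *)
    exists ((x v - x u)^-1, - x u / (x v - x u)); split=> [|w lw] /=.
      by rewrite -invr_signM invr_gt0.
    rewrite -/(x w); have := find w lw; case: (chi01 w) => ->; rewrite ?D0 ?D1 => -[<-].
      by field.
    by field.
  (* A single vertex leaves the slope free, so the prescribed sign itself is taken and the offset
     moves the vertex to its rank. *)
  exists ((-1) ^+ s, - ((-1) ^+ s * x u)); split=> // w lw /=.
  rewrite -/(x w); have := find w lw; case: (chi01 w) => ->; rewrite ?D0 ?D1 // => -[<-].
  by rewrite subrr.
case D1: (slot G i 1) => [v|].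
  exists ((-1) ^+ s, 1 - ((-1) ^+ s * x v)); split=> // w lw /=.
  rewrite -/(x w); have := find w lw; case: (chi01 w) => ->; rewrite ?D0 ?D1 // => -[<-].
  by rewrite addrC subrK.
exists ((-1) ^+ s, 0); split=> // w lw.
by have := find w lw; case: (chi01 w) => ->; rewrite ?D0 ?D1.
Qed.

Lemma restricted_planar : ordered_level_planar R G.
Proof.
have [s lt_s] := post_order.
have [ab abP] := choice (fun i => level_scaling (lt_s i)).
pose alpha : R -> R := interpolate (fun i => (ab i).1).
pose beta : R -> R := interpolate (fun i => (ab i).2).
pose phi (p : R * R) : R * R := (alpha p.2 * p.1 + beta p.2, p.2).
(* Injectivity is claimed only on the strip of levels, where the interpolated slope is known not to
   vanish. *)
have phi_inj (p q : R * R) : 0 <= p.2 <= h%:R -> phi p = phi q -> p = q.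
  case: p q => [x y] [x' y'] /= y01 [E Ey]; rewrite -{}Ey in E *; congr pair.
  have {}E := addIr _ E.
  apply: mulfI E; apply: (interpolate_neq0 (s := (-1) ^+ s) _ y01) => i.
  by have [] := abP i.
have phi_continuous : continuous phi.
  move=> p; apply: (cvg_pair (G := nbhs _) (H := nbhs p.2)); last exact: cvg_snd.
  have comp2 (f : R -> R) : continuous f -> f q.2 @[q --> p] --> f p.2.
    by move=> cf; apply: (@cvg_comp _ _ _ snd f _ (nbhs p.2)) (cf _); exact: cvg_snd.
  apply: cvgD; last by apply: comp2; exact: continuous_interpolate.
  by apply: cvgM; [apply: comp2; exact: continuous_interpolate|exact: cvg_fst].
pose D0 : drawing R G := Drawing (fun v => (chi v)%:R) (fun e => phi \o curve D (old_edge e)).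
have pos v : position D0 v = phi (position D (old h v)).
  rewrite /phi /position level_old /= /alpha /beta !interpolate_nat.
  by have [_ ->] := abP (level v).
have level_h v : 0 <= (position D v).2 <= h%:R.
  by rewrite /position /= ler0n ler_nat -ltnS ltn_ord.
(* Incidences pull back along [phi]: a curve stays between the heights of its endpoints, hence
   inside the strip where [phi] is injective. *)
have on e z : e \in edges G -> on_curve (curve D0 e) (phi z) -> on_curve (curve D (old_edge e)) z.
  move=> eG [t [t0 t1 E]]; exists t; split=> //; apply: phi_inj E.
  have t01 : 0 <= t <= 1 by rewrite t0.
  have eH : old_edge e \in edges H by rewrite old_edge_new.
  have /andP[lo hi] := upward_height (edges_upward D_planar eH) t01.
  have /andP[lo' _] := level_h (old_edge e).1; have /andP[_ hi'] := level_h (old_edge e).2.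
  by rewrite (le_trans lo' lo) (le_trans hi hi').
exists D0; split=> //; split.
- move=> u v; rewrite !pos => /phi_inj -/(_ (level_h _)) /(vertices_distinct D_planar)/eqP.
  by rewrite eq_old => /eqP.
- move=> e eG; have eH : old_edge e \in edges H by rewrite old_edge_new.
  have [cc c0 c1 up] := edges_upward D_planar eH.
  split=> [||| a b a0 ab' b1]; rewrite ?pos /=.
  + by apply: within_continuous_comp cc => z _; exact: phi_continuous.
  + by rewrite c0.
  + by rewrite c1.
  + exact: up.
- move=> e v eG; rewrite pos => /(on _ _ eG).
  have eH : old_edge e \in edges H by rewrite old_edge_new.
  by move/(edges_avoid_vertices D_planar eH); rewrite is_end_old.
(* The common point is [phi] of a point of the first old curve, which then lies on the second one
   too. The vertex where these curves meet is not a post, since no old edge ends at one. *)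
- move=> e f p eG fG ne [t [t0 t1 <-]] of_.
  have [|||||v [ve vf E]] := @edges_crossing_free _ _ _ D_planar (old_edge e) (old_edge f)
      (curve D (old_edge e) t).
  + by rewrite old_edge_new.
  + by rewrite old_edge_new.
  + by move/old_edge_inj.
  + by exists t.
  + exact: on of_.
  move: ve vf E; case: (vertexP v) => [w|b i]; last by rewrite post_end_old.
  by rewrite !is_end_old => we wf E; exists w; rewrite pos -E.
Qed.

End Backward.
End Drawings.

Theorem theorem4 (R : realType) :
  exists (p : prog) (C : nat),
    forall G : ordered_level_graph,
      max_degree G = 2%N -> level_width G = 2%N ->
      exists H : T_level_graph,
        [/\ computes_in_linear_time p C (encode_ordered G) (encode_T H),
            max_degree H = 2%N,
            level_width H = 4%N &
            ordered_level_planar R G <-> T_level_planar R H].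
Proof.
exists reduction, 100%N => G d2 w2.
have width2 i : (width (G := G) i <= 2)%N by rewrite -w2; apply: bigop.leq_bigmax.
exists (new_T_graph width2); split.
- exact: linear_time_reduction.
- exact: max_degree_new_graph.
- exact: level_width_new_graph.
split=> [[D [planar xD]]|[D [planar consecutive]]].
  have [|M M1 MP] := @curves_bounded R _ (edges G) (curve D).
    by move=> e /(edges_upward planar)[].
  exact: extended_T_planar planar xD M1 MP.
exact: restricted_planar planar consecutive.
Qed.
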